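(* Let $R$ be a skew-invertible involutive symmetry, $\mathbf{Y}(R)$ the corresponding braided Yangian with generating matrix $L(u)$, and let $M$ be the generating matrix of the modified Reflection Equation algebra $\mathcal{L}(R,1)$. Then the map $$L(u)\mapsto I+\frac{M}{u}$$ (i.e. $L[1]\mapsto M$, $L[k]\mapsto0$ for $k\ge2$) defines a surjective algebra morphism $\mathbf{Y}(R)\to\mathcal{L}(R,1)$. Besides, the map $M\mapsto L[1]$ defines an injective algebra morphism $\mathcal{L}(R,1)\to\mathbf{Y}(R)$.
   Context: $V$ is an $N$-dimensional vector space over $\mathbb{K}=\mathbb{R}$ or $\mathbb{C}$ with a fixed basis $\{x_i\}$; an operator $R$ on $V^{\otimes 2}$ has matrix given by $R(x_i\otimes x_j)=R_{ij}^{ks}x_k\otimes x_s$ (summation over repeated indices). Lower indices on matrices indicate tensor factors: $R_{12}=R\otimes I$, $R_{23}=I\otimes R$, $L_1=L\otimes I$. Involutive symmetry: $R_{12}R_{23}R_{12}=R_{23}R_{12}R_{23}$ and $R^2=I$. Skew-invertible: there is $\Psi$ on $V^{\otimes 2}$ with $R_{ij}^{kl}\Psi_{lp}^{jq}=\delta_i^{q}\delta_p^k$. Braided Yangian: let $R(u,v)=R-\frac{1}{u-v}I$. $\mathbf{Y}(R)$ is the unital associative algebra generated by the entries $l_i^j[k]$ ($1\le i,j\le N$, $k\ge1$) of matrices $L[k]$, where $L(u)=\sum_{k\ge0}L[k]u^{-k}$, $L[0]=I$, subject to the relations obtained by expanding $$R(u,v)L_1(u)RL_1(v)=L_1(v)RL_1(u)R(u,v).$$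 Modified Reflection Equation algebra: $\mathcal{L}(R,1)$ is the unital associative algebra generated by the entries $m_i^j$ of an $N\times N$ matrix $M$ subject to $RM_1RM_1-M_1RM_1R-(RM_1-M_1R)=0$. *)

(* Defs.v *)
From HB Require Import structures.
From mathcomp Require Import all_boot all_order all_algebra.
From mathcomp Require Import generic_quotient ring_quotient.
From mathcomp Require Import boolp.
From mathcomp Require Import mxtens monalg.

Set Implicit Arguments.
Unset Strict Implicit.
Unset Printing Implicit Defensive.

Import GRing.Theory.
Local Open Scope ring_scope.
Local Open Scope quotient_scope.

(* {malg K[{fmonom X}]} is the free unital associative K-algebra on X. *)

Section FreeAlgebra.
Variables (K : fieldType) (X : choiceType).
Local Notation F := {malg K[{fmonom X}]}.

Definition free_gen (x : X) : F := << fmu x >>.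

Lemma free_scalerAr (c : K) (f g : F) : c *: (f * g) = f * (c *: g).
Proof.
have comC : f * c%:MP = c%:MP * f.
  rewrite malgM_def mul_malgC fgmulgU malgZ_def /fgscale.
  by apply: eq_bigr => k _; rewrite mulm1 mulrC.
rewrite -(mul_malgC c (f * g)) -(mul_malgC c g) [LHS]mulrA -comC mulrA.
reflexivity.
Qed.

Lemma mcoeff1_free_gen x : (free_gen x)@_mone = 0 :> K.
Proof. by rewrite mcoeffU fm1_eq1. Qed.

(* The two-sided ideal generated by rel. *)
Inductive in_ideal (rel : F -> Prop) : F -> Prop :=
| in_ideal0 : in_ideal rel 0
| in_idealD (f a r b : F) : in_ideal rel f -> rel r -> in_ideal rel (f + a * r * b).

Lemma in_ideal_add rel f g :
  in_ideal rel f -> in_ideal rel g -> in_ideal rel (f + g).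
Proof.
move=> If; elim=> [|h a r b _ Ih rr]; first by rewrite addr0.
by rewrite addrA; apply: in_idealD.
Qed.

Lemma in_ideal_mull rel a f : in_ideal rel f -> in_ideal rel (a * f).
Proof.
elim=> [|h c r b _ Ih rr]; first by rewrite mulr0; apply: in_ideal0.
by rewrite mulrDr !mulrA; apply: in_idealD.
Qed.

Lemma in_ideal_mulr rel a f : in_ideal rel f -> in_ideal rel (f * a).
Proof.
elim=> [|h c r b _ Ih rr]; first by rewrite mul0r; apply: in_ideal0.
by rewrite mulrDl -!mulrA mulrA; apply: in_idealD.
Qed.

Lemma in_ideal_opp rel f : in_ideal rel f -> in_ideal rel (- f).
Proof. by move=> If; rewrite -mulN1r; apply: in_ideal_mull. Qed.

Lemma in_ideal_scale rel (c : K) f : in_ideal rel f -> in_ideal rel (c *: f).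
Proof. by move=> If; rewrite -mul_malgC; apply: in_ideal_mull. Qed.

(* MathComp algebras are nonzero rings, hence the second field. *)
Record relators := Relators {
  relator :> F -> Prop;
  relators_proper : ~ in_ideal relator 1
}.

Lemma augmented_proper (rel : F -> Prop) :
  (forall r, rel r -> r@_mone = 0) -> ~ in_ideal rel 1.
Proof.
move=> rel0 I1; suff: (1 : F)@_mone = 0 by apply/eqP; rewrite mcoeff1 eqxx oner_eq0.
elim: I1 => [|f a r b _ f0 /rel0 r0]; first exact: mcoeff0.
by rewrite mcoeffD f0 add0r !rmorphM /= r0 mulr0 mul0r.
Qed.

End FreeAlgebra.

Section PresentedAlgebra.
Variables (K : fieldType) (X : choiceType) (rel : relators K X).
Local Notation F := {malg K[{fmonom X}]}.

Definition ideal : {pred F} := [pred f | `[< in_ideal rel f >]].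

Lemma idealP f : reflect (in_ideal rel f) (f \in ideal).
Proof. exact: asboolP. Qed.

Fact ideal_zmod_closed : zmod_closed ideal.
Proof.
split=> [|f g /idealP If /idealP Ig]; apply/idealP; first exact: in_ideal0.
by apply: in_ideal_add => //; apply: in_ideal_opp.
Qed.
HB.instance Definition _ := GRing.isZmodClosed.Build F ideal ideal_zmod_closed.

(* The quotient of the free algebra by the ideal generated by the relators. *)
Definition presented := {ideal_quot ideal}.

HB.instance Definition _ := GRing.Zmodule.on presented.

Definition presented_pi (f : F) : presented := \pi_{ideal_quot ideal} f.

Lemma presented_eqP f g :
  presented_pi f = presented_pi g <-> in_ideal rel (f - g).
Proof.
rewrite /presented_pi; split=> [/eqP|/idealP].
  by rewrite -Quotient.idealrBE => /idealP.
by rewrite Quotient.idealrBE => /eqP.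
Qed.

Definition presented_repr (x : presented) : F := repr (x : {ideal_quot ideal}).

Lemma presented_reprK : cancel presented_repr presented_pi.
Proof. by move=> x; apply: reprK. Qed.

Lemma presented_pi_zmod : zmod_morphism presented_pi.
Proof. by move=> f g; rewrite /presented_pi !piE. Qed.
HB.instance Definition _ :=
  GRing.isZmodMorphism.Build F presented presented_pi presented_pi_zmod.

Definition presented_mul (x y : presented) : presented :=
  presented_pi (presented_repr x * presented_repr y).
Definition presented_scale (c : K) (x : presented) : presented :=
  presented_pi (c *: presented_repr x).

Lemma presented_mulE f g :
  presented_mul (presented_pi f) (presented_pi g) = presented_pi (f * g).
Proof.
apply/presented_eqP.
set f' := presented_repr _; set g' := presented_repr _.
have -> : f' * g' - f * g = (f' - f) * g' + f * (g' - g).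
  by rewrite mulrBl mulrBr addrA subrK.
apply: in_ideal_add; [apply: in_ideal_mulr|apply: in_ideal_mull];
  by apply/presented_eqP; rewrite presented_reprK.
Qed.

Lemma presented_scaleE c f :
  presented_scale c (presented_pi f) = presented_pi (c *: f).
Proof.
apply/presented_eqP; rewrite -scalerBr; apply: in_ideal_scale.
by apply/presented_eqP; rewrite presented_reprK.
Qed.

Local Notation pE := (presented_mulE, presented_scaleE).

Fact presented_mulA : associative presented_mul.
Proof.
move=> x y z; rewrite -[x]presented_reprK -[y]presented_reprK.
by rewrite -[z]presented_reprK !pE mulrA.
Qed.
Fact presented_mul1 : left_id (presented_pi 1) presented_mul.
Proof. by move=> x; rewrite -[x]presented_reprK !pE mul1r. Qed.
Fact presented_mulr1 : right_id (presented_pi 1) presented_mul.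
Proof. by move=> x; rewrite -[x]presented_reprK !pE mulr1. Qed.
Fact presented_mulDl : left_distributive presented_mul +%R.
Proof.
move=> x y z; rewrite -[x]presented_reprK -[y]presented_reprK.
by rewrite -[z]presented_reprK -raddfD !pE mulrDl raddfD.
Qed.
Fact presented_mulDr : right_distributive presented_mul +%R.
Proof.
move=> x y z; rewrite -[x]presented_reprK -[y]presented_reprK.
by rewrite -[z]presented_reprK -raddfD !pE mulrDr raddfD.
Qed.
Fact presented_1neq0 : presented_pi 1 != 0.
Proof.
apply/eqP; rewrite -(raddf0 presented_pi) => /presented_eqP.
by rewrite subr0; apply: relators_proper.
Qed.
HB.instance Definition _ := GRing.Zmodule_isNzRing.Build presented
  presented_mulA presented_mul1 presented_mulr1
  presented_mulDl presented_mulDr presented_1neq0.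

Fact presented_scaleA a b x :
  presented_scale a (presented_scale b x) = presented_scale (a * b) x.
Proof. by rewrite -[x]presented_reprK !pE scalerA. Qed.
Fact presented_scale1 : left_id 1 presented_scale.
Proof. by move=> x; rewrite -[x]presented_reprK !pE scale1r. Qed.
Fact presented_scaleDr : right_distributive presented_scale +%R.
Proof.
move=> c x y; rewrite -[x]presented_reprK -[y]presented_reprK.
by rewrite -raddfD !pE scalerDr raddfD.
Qed.
Fact presented_scaleDl x : {morph presented_scale^~ x : a b / a + b}.
Proof. by move=> a b; rewrite -[x]presented_reprK !pE scalerDl raddfD. Qed.
HB.instance Definition _ := GRing.Zmodule_isLmodule.Build K presented
  presented_scaleA presented_scale1 presented_scaleDr presented_scaleDl.

Fact presented_scaleAl c (x y : presented) : c *: (x * y) = (c *: x) * y.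
Proof.
rewrite -[x]presented_reprK -[y]presented_reprK /GRing.mul /GRing.scale /=.
by rewrite !pE scalerAl.
Qed.
HB.instance Definition _ := GRing.Lmodule_isLalgebra.Build K presented
  presented_scaleAl.

Fact presented_scaleAr c (x y : presented) : c *: (x * y) = x * (c *: y).
Proof.
rewrite -[x]presented_reprK -[y]presented_reprK /GRing.mul /GRing.scale /=.
by rewrite !pE free_scalerAr.
Qed.
HB.instance Definition _ := GRing.Lalgebra_isAlgebra.Build K presented
  presented_scaleAr.

Fact presented_pi_monoid_morphism : monoid_morphism presented_pi.
Proof. split=> [|f g]; [reflexivity | exact: esym (presented_mulE f g)]. Qed.
HB.instance Definition _ :=
  GRing.isMonoidMorphism.Build F presented presented_pi
    presented_pi_monoid_morphism.

Fact presented_pi_scalable : scalable presented_pi.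
Proof. by move=> c f; rewrite -presented_scaleE. Qed.
HB.instance Definition _ :=
  GRing.isScalable.Build K F presented *:%R presented_pi presented_pi_scalable.

End PresentedAlgebra.

Section Symmetries.
Variables (K : fieldType) (N : nat).

(* Lower indices number rows and upper indices columns, so that row vectors  *)
(* realize R (x_i (x) x_j) = R_{ij}^{ks} x_k (x) x_s, and R_{ij}^{ks} is the *)
(* entry R (mxtens_index (i, j)) (mxtens_index (k, s)).                      *)

Definition symmetry_12 (R : 'M[K]_(N * N)) : 'M[K]_(N * N * N) :=
  R *t (1%:M : 'M_N).

Definition symmetry_23 (R : 'M[K]_(N * N)) : 'M[K]_(N * N * N) :=
  castmx (mulnA N N N, mulnA N N N) ((1%:M : 'M_N) *t R).

Definition involutive_symmetry (R : 'M[K]_(N * N)) : Prop :=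
  symmetry_12 R *m symmetry_23 R *m symmetry_12 R
    = symmetry_23 R *m symmetry_12 R *m symmetry_23 R
  /\ R *m R = 1%:M.

Definition skew_invertible (R : 'M[K]_(N * N)) : Prop :=
  exists Psi : 'M[K]_(N * N), forall i k p q : 'I_N,
    \sum_(j < N) \sum_(l < N)
      R (mxtens_index (i, j)) (mxtens_index (k, l))
      * Psi (mxtens_index (l, p)) (mxtens_index (j, q))
    = (i == q)%:R * (p == k)%:R.

End Symmetries.

Section Relations.
Variables (A : pzRingType) (N : nat) (R : 'M[A]_(N * N)).

Definition tens1 (M : 'M[A]_N) : 'M[A]_(N * N) := M *t (1%:M : 'M_N).

Definition mrea_relation (M : 'M[A]_N) : 'M[A]_(N * N) :=
  let M1 := tens1 M in
  R *m M1 *m R *m M1 - M1 *m R *m M1 *m R - (R *m M1 - M1 *m R).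

Variable L : nat -> 'M[A]_N.

(* The coefficient of v^-b in L_1(v). *)
Definition L1coef (b : int) : 'M[A]_(N * N) :=
  if b is Posz k then tens1 (L k) else 0.

(* With 1 / (u - v) expanded as \sum_(p >= 1) u^-p v^(p-1), the coefficients *)
(* of u^-a v^-b in R(u,v) L_1(u) R L_1(v) and L_1(v) R L_1(u) R(u,v); here   *)
(* b may be negative. Equating them for all a and b is equivalent to         *)
(* equating the coefficients after multiplication by u - v.                  *)
Definition yangian_lhs (a : nat) (b : int) : 'M[A]_(N * N) :=
  R *m tens1 (L a) *m R *m L1coef b
  - \sum_(1 <= p < a.+1) tens1 (L (a - p)) *m R *m L1coef (b + p%:Z - 1).

Definition yangian_rhs (a : nat) (b : int) : 'M[A]_(N * N) :=
  L1coef b *m R *m tens1 (L a) *m R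
  - \sum_(1 <= p < a.+1) L1coef (b + p%:Z - 1) *m R *m tens1 (L (a - p)).

End Relations.

Section RelationsMap.
Variables (A B : pzRingType) (phi : {rmorphism A -> B}) (N : nat).
Local Notation "x ^f" := (map_mx phi x).

Lemma map_tens1 (M : 'M[A]_N) : (tens1 M)^f = tens1 M^f.
Proof.
apply/matrixP=> i j; rewrite !mxE rmorphM /= rmorph_nat //.
Qed.

Lemma map_mrea_relation (R : 'M[A]_(N * N)) M :
  (mrea_relation R M)^f = mrea_relation R^f M^f.
Proof. by rewrite /mrea_relation !(map_mxB, map_mxM) /= !map_tens1. Qed.

Lemma map_L1coef (L : nat -> 'M[A]_N) b :
  (L1coef L b)^f = L1coef (fun k => (L k)^f) b.
Proof. by case: b => k /=; rewrite (map_tens1, map_mx0). Qed.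

Lemma map_yangian_lhs (R : 'M[A]_(N * N)) L a b :
  (yangian_lhs R L a b)^f = yangian_lhs R^f (fun k => (L k)^f) a b.
Proof.
rewrite /yangian_lhs map_mxB !map_mxM map_tens1 map_L1coef raddf_sum.
by under eq_bigr do rewrite /= !map_mxM map_tens1 map_L1coef.
Qed.

Lemma map_yangian_rhs (R : 'M[A]_(N * N)) L a b :
  (yangian_rhs R L a b)^f = yangian_rhs R^f (fun k => (L k)^f) a b.
Proof.
rewrite /yangian_rhs map_mxB !map_mxM map_tens1 map_L1coef raddf_sum.
by under eq_bigr do rewrite /= !map_mxM map_tens1 map_L1coef.
Qed.

Lemma map_mrea_entry (R : 'M[A]_(N * N)) M i j :
  phi (mrea_relation R M i j) = mrea_relation R^f M^f i j.
Proof. by rewrite -map_mrea_relation [RHS]mxE. Qed.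

Lemma map_yangian_entry (R : 'M[A]_(N * N)) L a b i j :
  phi ((yangian_lhs R L a b - yangian_rhs R L a b) i j)
  = (yangian_lhs R^f (fun k => (L k)^f) a b
     - yangian_rhs R^f (fun k => (L k)^f) a b) i j.
Proof.
by rewrite -map_yangian_lhs -map_yangian_rhs -map_mxB [RHS]mxE.
Qed.

End RelationsMap.

Lemma tens1_scalar (A : comPzRingType) N (c : A) :
  tens1 (c%:M : 'M_N) = c%:M.
Proof.
apply/matrixP=> i j; case: (mxtens_indexP i) => i1 i2.
case: (mxtens_indexP j) => j1 j2; rewrite tensmxE !mxE.
rewrite (can_eq (@mxtens_indexK N N)) xpair_eqE.
by case: (i1 == j1); case: (i2 == j2); rewrite ?mulr1n ?mulr0n ?mulr0 ?mulr1 ?mul0r.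
Qed.

Lemma yangian_scalar (A : comPzRingType) N (R : 'M[A]_(N * N)) (c : nat -> A) a b :
  yangian_lhs R (fun k => (c k)%:M) a b = yangian_rhs R (fun k => (c k)%:M) a b.
Proof.
have LE b' : exists d : A, L1coef (fun k => (c k)%:M : 'M_N) b' = d%:M.
  case: b' => k /=; first by exists (c k); rewrite tens1_scalar.
  by exists 0; rewrite raddf0.
have comm (x y : A) : x%:M *m R *m y%:M = y%:M *m R *m x%:M.
  by rewrite !mul_mx_scalar !mul_scalar_mx !scalerA mulrC.
rewrite /yangian_lhs /yangian_rhs; congr (_ - _); last first.
  by apply: eq_bigr => p _; rewrite tens1_scalar; case: (LE (b + p%:Z - 1)) => e ->.
rewrite tens1_scalar; case: (LE b) => d ->.
by rewrite !(mul_mx_scalar, mul_scalar_mx) -!scalemxAl !scalerA mulrC.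
Qed.

Section BraidedAlgebras.
Variables (K : fieldType) (N : nat) (R : 'M[K]_(N * N)).

Definition scalar_ext (A : lalgType K) : 'M[A]_(N * N) := map_mx (in_alg A) R.

Definition mrea_free_M : 'M[{malg K[{fmonom ('I_N * 'I_N)%type}]}]_N :=
  \matrix_(i, j) free_gen K (i, j).

Definition mrea_relator r : Prop :=
  exists i j, r = mrea_relation (scalar_ext _) mrea_free_M i j.

(* The generator (i, j, k) is l_i^j[k+1]. *)
Definition yangian_free_L (k : nat) :
    'M[{malg K[{fmonom ('I_N * 'I_N * nat)%type}]}]_N :=
  if k is k'.+1 then \matrix_(i, j) free_gen K (i, j, k') else 1%:M.

Definition yangian_relator r : Prop :=
  exists a b i j, r = (yangian_lhs (scalar_ext _) yangian_free_L a b
                       - yangian_rhs (scalar_ext _) yangian_free_L a b) i j.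

Lemma mcoeff1_scalar_ext (X : choiceType) :
  map_mx (@mcoeff {fmonom X} K mone) (scalar_ext _) = R.
Proof. by apply/matrixP=> i j; rewrite !mxE mcoeffZ mcoeff1 eqxx mulr1. Qed.

Fact mrea_proper : ~ in_ideal mrea_relator 1.
Proof.
apply: augmented_proper => r [i [j ->]].
rewrite (map_mrea_entry (@mcoeff {fmonom _} K mone)) mcoeff1_scalar_ext.
have -> : map_mx (mcoeff mone) mrea_free_M = 0%:M :> 'M[K]_N.
  by apply/matrixP=> k l; rewrite !mxE mcoeff1_free_gen mul0rn.
by rewrite /mrea_relation tens1_scalar raddf0 !(mulmx0, mul0mx) !subr0 mxE.
Qed.

Fact yangian_proper : ~ in_ideal yangian_relator 1.
Proof.
apply: augmented_proper => r [a [b [i [j ->]]]].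
rewrite (map_yangian_entry (@mcoeff {fmonom _} K mone)) mcoeff1_scalar_ext.
have -> : (fun k => map_mx (mcoeff mone) (yangian_free_L k))
          = (fun k => (k == 0)%N%:R%:M : 'M[K]_N).
  apply/funext => -[|k]; apply/matrixP=> x y; rewrite !mxE.
    by case: (x == y); rewrite ?mcoeff0 ?mcoeff1 ?eqxx.
  by rewrite mcoeff1_free_gen mul0rn.
by rewrite yangian_scalar subrr mxE.
Qed.

(* L(R,1), with generating matrix mrea_M. *)
Definition mrea := presented (Relators mrea_proper).
Definition mrea_M : 'M[mrea]_N := map_mx (presented_pi _) mrea_free_M.

(* Y(R), with yangian_L k the matrix L[k]. *)
Definition yangian := presented (Relators yangian_proper).
Definition yangian_L (k : nat) : 'M[yangian]_N :=
  map_mx (presented_pi _) (yangian_free_L k).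

HB.instance Definition _ := GRing.Algebra.on mrea.
HB.instance Definition _ := GRing.Algebra.on yangian.

End BraidedAlgebras.

(* Main.v *)
(* Write D(c,d) = L[c]_1 R L[d]_1 - L[d]_1 R L[c]_1. For L(u) = I + M/u and    *)
(* R^2 = I, the only terms R L[a]_1 R L[b]_1 - L[b]_1 R L[a]_1 R that survive  *)
(* have a = b = 1, while the part of the Yangian relation coming from          *)
(* 1 / (u - v) is the sum of D(a-p, b+p-1) over p, in which D(0,1) and D(1,0)  *)
(* cancel unless a = b = 1. The coefficient of u^-1 v^-1 is the relation of    *)
(* L(R,1), both for this L(u) and for L[1] in Y(R), so both maps are defined.  *)
(* The composite L(R,1) -> Y(R) -> L(R,1) fixes the generators, hence is the   *)
(* identity, which gives surjectivity and injectivity at once.                 *)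

Require Import Defs.
From HB Require Import structures.
From mathcomp Require Import all_boot all_order all_algebra.
From mathcomp Require Import reals complex.
From mathcomp Require Import mxtens monalg.

Set Implicit Arguments.
Unset Strict Implicit.
Unset Printing Implicit Defensive.

Import GRing.Theory.
Local Open Scope ring_scope.

(** Both algebras are given by generators and relators, so a morphism out of either is a choice of
    images of the generators that kills the relators ([presented_lift]), and these images determine
    it ([presented_lrmorphism_ext]). From [mrea R] to [yangian R] the relators die by the single
    coefficient identity [yangian11_mrea]; in the other direction [truncated_yangian] checks all
    coefficients, using [R *m R = 1%:M]. Injectivity then requires no basis of either algebra: a
    left inverse is at hand. *)

Section FreeLift.
Variables (K : fieldType) (X : choiceType) (A : algType K) (h : X -> A).
Local Notation F := {malg K[{fmonom X}]}.

Definition fmonom_eval (m : {fmonom X}) : A := \prod_(x <- m) h x.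

Fact fmonom_eval_mmorphism : mmorphism fmonom_eval.
Proof.
by split=> [m1 m2|]; rewrite /fmonom_eval ?fm1 ?big_nil // fmM big_cat.
Qed.
HB.instance Definition _ :=
  isMultiplicative.Build {fmonom X} A fmonom_eval fmonom_eval_mmorphism.

Definition free_lift : F -> A := mmap (in_alg A) fmonom_eval.

HB.instance Definition _ := GRing.Additive.on free_lift.

Fact free_lift_monoid_morphism : monoid_morphism free_lift.
Proof.
have [mulM one1] : multiplicative free_lift.
  (* Scalars are central in [A], so multiplicativity on words is enough. *)
  apply: commr_mmap_is_multiplicative => g m m'.
  by rewrite /GRing.comm /= mulr_algl mulr_algr.
by split.
Qed.
HB.instance Definition _ :=
  GRing.isMonoidMorphism.Build F A free_lift free_lift_monoid_morphism.

Fact free_lift_scalable : scalable free_lift.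
Proof. by move=> c f; rewrite /free_lift mmapZ /= mulr_algl. Qed.
HB.instance Definition _ :=
  GRing.isScalable.Build K F A *:%R free_lift free_lift_scalable.

Lemma free_lift_gen x : free_lift (free_gen K x) = h x.
Proof.
by rewrite /free_lift /free_gen mmapU /= scale1r mul1r /fmonom_eval fmU big_seq1.
Qed.

End FreeLift.

(** A noncommutative polynomial is a linear combination of words, and a word is a product of
    generators. *)
Lemma free_lrmorphism_ext (K : fieldType) (X : choiceType) (A : lalgType K)
    (f g : {lrmorphism {malg K[{fmonom X}]} -> A}) :
  (forall x, f (free_gen K x) = g (free_gen K x)) -> f =1 g.
Proof.
move=> fg p; rewrite [p]monalgE !raddf_sum; apply: eq_bigr => m _.
have -> : << p@_m *g m >> = p@_m *: << m >> :> {malg K[{fmonom X}]}.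
  by apply/malgP=> k; rewrite mcoeffU mcoeffZ mcoeffU1 mulr_natr.
rewrite /= !linearZ /=; congr (_ *: _).
case: m => s; elim: s => [|x s IHs].
  have -> : FMonom [::] = mone :> {fmonom X} by apply/val_inj; rewrite /= fm1.
  by rewrite [<< _ >>](_ : _ = 1) ?rmorph1.
have -> : << FMonom (x :: s) >> = free_gen K x * << FMonom s >>.
  rewrite malgM_def fgmulUU mulr1; congr << _ >>.
  by apply/val_inj; rewrite /= fmM fmU.
by rewrite !rmorphM /= IHs fg.
Qed.

(** * Universal property of a presented algebra *)

Section PresentedLift.
Variables (K : fieldType) (X : choiceType) (rel : relators K X) (A : algType K).

Lemma presented_lrmorphism_ext (f g : {lrmorphism presented rel -> A}) :
  (forall x, f (presented_pi rel (free_gen K x))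
             = g (presented_pi rel (free_gen K x))) -> f =1 g.
Proof.
move=> fg x; rewrite -[x]presented_reprK.
pose pi : {lrmorphism {malg K[{fmonom X}]} -> presented rel} := presented_pi rel.
exact: (free_lrmorphism_ext (f := f \o pi) (g := g \o pi) fg).
Qed.

Lemma presented_relator0 r : rel r -> presented_pi rel r = 0.
Proof.
move=> rel_r; rewrite -(raddf0 (presented_pi rel)); apply/presented_eqP.
rewrite subr0 -[r]add0r -[r]mulr1 -[r]mul1r.
by apply: in_idealD => //; apply: in_ideal0.
Qed.

Lemma presented_lift (h : X -> A) :
  (forall r, rel r -> free_lift h r = 0) ->
  exists f : {lrmorphism presented rel -> A},
    forall x, f (presented_pi rel (free_gen K x)) = h x.
Proof.
move=> rel0.
have ideal0 p : in_ideal rel p -> free_lift h p = 0.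
  elim=> [|q a r b _ q0 /rel0 r0]; first exact: raddf0.
  by rewrite raddfD /= !rmorphM /= q0 r0 mulr0 mul0r addr0.
(* [f] is computed on a chosen representative; [fE] shows that the choice is immaterial, as
   representatives differ by elements of the ideal. The morphism laws then descend from
   [free_lift]. *)
pose f (x : presented rel) := free_lift h (presented_repr x).
have fE p : f (presented_pi rel p) = free_lift h p.
  apply/eqP; rewrite -subr_eq0 -raddfB; apply/eqP/ideal0/presented_eqP.
  exact: presented_reprK.
have fB : zmod_morphism f.
  move=> x y; rewrite -[x]presented_reprK -[y]presented_reprK.
  by rewrite -raddfB !fE raddfB.
have fM : monoid_morphism f.
  split=> [|x y]; first by rewrite -(rmorph1 (presented_pi rel)) fE rmorph1.
  rewrite -[x]presented_reprK -[y]presented_reprK.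
  by rewrite -rmorphM !fE rmorphM.
have fZ : scalable f.
  move=> c x; rewrite -[x]presented_reprK.
  by rewrite -presented_pi_scalable !fE linearZ.
pose fa := GRing.isZmodMorphism.Build _ _ f fB.
pose fm := GRing.isMonoidMorphism.Build _ _ f fM.
pose fs := GRing.isScalable.Build K _ A *:%R f fZ.
pose F : {lrmorphism presented rel -> A} := HB.pack f fa fm fs.
by exists F => x; rewrite [LHS]fE free_lift_gen.
Qed.

End PresentedLift.

Lemma tens1_id (A : pzRingType) N : tens1 (1%:M : 'M[A]_N) = 1%:M.
Proof.
apply/matrixP=> i j; case: (mxtens_indexP i) => i1 i2.
case: (mxtens_indexP j) => j1 j2; rewrite tensmxE !mxE.
rewrite (can_eq (@mxtens_indexK N N)) xpair_eqE.
by case: (i1 == j1); rewrite ?mul1r ?mul0r.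
Qed.

(** The entries of [R] are scalars, so algebra morphisms carry relations to relations with the same
    [R]. *)
Lemma map_scalar_ext (K : fieldType) N (R : 'M[K]_(N * N)) (A B : lalgType K)
    (f : {lrmorphism A -> B}) :
  map_mx f (scalar_ext R A) = scalar_ext R B.
Proof. by apply/matrixP=> i j; rewrite !mxE /= linearZ rmorph1. Qed.

(** * Coefficients of the Yangian relation *)

Section TruncatedSeries.
Variables (A : pzRingType) (N : nat) (R : 'M[A]_(N * N)) (L : nat -> 'M[A]_N).
Hypotheses (RR : R *m R = 1%:M) (L0 : L 0 = 1%:M).

(** This coefficient involves only [L 0] and [L 1]; the single summand [p = 1], with [L 0 = 1%:M],
    gives the linear terms. It thus reads the same in [yangian R] and for [I + M/u]. *)
Lemma yangian11_mrea :
  yangian_lhs R L 1 1 - yangian_rhs R L 1 1 = mrea_relation R (L 1).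
Proof.
rewrite /yangian_lhs /yangian_rhs !big_nat1 subnn L0 /= tens1_id.
by rewrite mul1mx mulmx1 /mrea_relation !opprD addrACA.
Qed.

Lemma truncated_yangian (a : nat) (b : int) :
    mrea_relation R (L 1) = 0 -> (forall k, (2 <= k)%N -> L k = 0) ->
  yangian_lhs R L a b = yangian_rhs R L a b.
Proof.
move=> relM Lgt1.
have L20 k : tens1 (L k.+2) = 0 by rewrite Lgt1 // /tens1 tens0mx.
case: a => [|[|a]].
(* For [a = 0] the sum is empty, and both sides reduce to [L1coef L b] by involutivity. *)
- by rewrite /yangian_lhs /yangian_rhs !big_geq // L0 tens1_id !mulmx1 RR
    -mulmxA RR mul1mx mulmx1.
- case: b => [[|[|b]]|b].
  + rewrite /yangian_lhs /yangian_rhs !big_nat1 /= L0 tens1_id.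
    by rewrite !(mulmx1, mul1mx).
  + by apply/eqP; rewrite -subr_eq0 yangian11_mrea relM.
  + by rewrite /yangian_lhs /yangian_rhs !big_nat1 addrK /= L20
      !(mulmx0, mul0mx).
  + by rewrite /yangian_lhs /yangian_rhs !big_nat1 addrK /= !(mulmx0, mul0mx).
rewrite /yangian_lhs /yangian_rhs L20 !(mulmx0, mul0mx); congr (_ - _).
(* Only the last two summands survive, those containing [L 1] and [L 0]. *)
rewrite !(big_nat_recr a.+2) //= !(big_nat_recr a.+1) //=.
have shift i : (1 <= i < a.+1)%N -> L (a.+2 - i) = 0.
  by case/andP=> _ le_ia; rewrite Lgt1 // ltn_subRL addn1 ltnS.
rewrite !big_nat !big1; first last.
- by move=> i /shift ->; rewrite /tens1 tens0mx !mul0mx.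
- by move=> i /shift ->; rewrite /tens1 tens0mx mulmx0.
rewrite !add0r subSnn subnn L0 tens1_id mulmx1 mul1mx.
have -> : b + a.+2%:Z - 1 = b + a.+1%:Z - 1 + 1.
  by rewrite subrK -[in LHS]addn1 PoszD addrA addrK.
(* With [c] the integer analysed here, the sums are [L[1] R L[c] + R L[c+1]] and [L[c] R L[1] +
   L[c+1] R], each [L] in the first factor. They have swapped terms for [c = 0], agree termwise for
   [c = 1] and [c = -1], and vanish otherwise. *)
by case: (b + a.+1%:Z - 1) => [[|[|c]]|[|c]] /=;
  rewrite ?(add0n, subnn) ?L0 ?tens1_id ?L20 !(mulmx0, mul0mx, mulmx1, mul1mx)
    // addrC.
Qed.

End TruncatedSeries.

(** * The two morphisms *)

Section Morphisms.
Variables (K : fieldType) (N : nat) (R : 'M[K]_(N * N)).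

Lemma mrea_M_relation : mrea_relation (scalar_ext R (mrea R)) (mrea_M R) = 0.
Proof.
pose pi : {lrmorphism _ -> mrea R} := presented_pi _.
apply/matrixP=> i j; rewrite [RHS]mxE -(map_scalar_ext _ pi).
by rewrite -map_mrea_entry; apply: presented_relator0; exists i, j.
Qed.

Lemma yangian_L_relation a b :
  yangian_lhs (scalar_ext R (yangian R)) (yangian_L R) a b
  = yangian_rhs (scalar_ext R (yangian R)) (yangian_L R) a b.
Proof.
pose pi : {lrmorphism _ -> yangian R} := presented_pi _.
apply/subr0_eq/matrixP=> i j; rewrite [RHS]mxE.
rewrite -(map_scalar_ext _ pi) -map_yangian_entry.
by apply: presented_relator0; exists a, b, i, j.
Qed.

Lemma yangian_L0 : yangian_L R 0 = 1%:M.
Proof. exact: map_mx1. Qed.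

Lemma yangian_to_mrea :
  R *m R = 1%:M ->
  exists f : {lrmorphism yangian R -> mrea R},
    map_mx f (yangian_L R 1) = mrea_M R
    /\ forall k, (2 <= k)%N -> map_mx f (yangian_L R k) = 0.
Proof.
move=> RR.
(* Third index [0] labels the entries of [L[1]], since [L[0]] has no generators. *)
pose h (x : ('I_N * 'I_N * nat)%type) : mrea R :=
  if x.2 == 0%N then mrea_M R x.1.1 x.1.2 else 0.
have LE k : map_mx (free_lift h) (yangian_free_L K N k.+1)
            = if k == 0%N then mrea_M R else 0.
  apply/matrixP=> i j; rewrite [LHS]mxE [X in free_lift h X]mxE free_lift_gen.
  by case: k => [|k] //; rewrite [RHS]mxE.
have [|f fE] := @presented_lift K _ (Relators (@yangian_proper _ _ R)) (mrea R) h.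
  move=> _ [a [b [i [j ->]]]].
  rewrite map_yangian_entry map_scalar_ext.
  rewrite truncated_yangian ?subrr ?mxE ?LE ?mrea_M_relation ?map_mx1 //.
    by rewrite -map_mxM RR map_mx1.
  by case=> [|[|k]] // _; rewrite LE.
have fLE k : map_mx f (yangian_L R k.+1) = if k == 0%N then mrea_M R else 0.
  by rewrite -LE; apply/matrixP=> i j; rewrite !mxE fE free_lift_gen.
exists f; split; first exact: fLE.
by case=> [|[|k]] // _; rewrite fLE.
Qed.

Lemma mrea_to_yangian :
  exists g : {lrmorphism mrea R -> yangian R},
    map_mx g (mrea_M R) = yangian_L R 1.
Proof.
pose h (x : ('I_N * 'I_N)%type) := yangian_L R 1 x.1 x.2.
have ME : map_mx (free_lift h) (mrea_free_M K N) = yangian_L R 1.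
  apply/matrixP=> i j.
  by rewrite [LHS]mxE [X in free_lift h X]mxE free_lift_gen.
have [|g gE] := @presented_lift K _ (Relators (@mrea_proper _ _ R)) (yangian R) h.
  move=> _ [i [j ->]].
  rewrite map_mrea_entry map_scalar_ext ME -yangian11_mrea ?yangian_L0 //.
  by rewrite yangian_L_relation subrr mxE.
by exists g; rewrite -ME; apply/matrixP=> i j; rewrite !mxE gE free_lift_gen.
Qed.

End Morphisms.

Theorem proposition14 (RR : realType) (K : fieldType)
    (hK : K = (RR : fieldType) \/ K = (complex RR : fieldType))
    (N : nat) (R : 'M[K]_(N * N))
    (hR : involutive_symmetry R) (hskew : skew_invertible R) :
  (exists f : {lrmorphism yangian R -> mrea R},
      [/\ map_mx f (yangian_L R 1) = mrea_M R,
          forall k : nat, (2 <= k)%N -> map_mx f (yangian_L R k) = 0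
        & forall y : mrea R, exists x : yangian R, f x = y])
  /\ (exists g : {lrmorphism mrea R -> yangian R},
      map_mx g (mrea_M R) = yangian_L R 1 /\ injective g).
Proof.
have [f [f1 fgt1]] := yangian_to_mrea hR.2.
have [g gM] := mrea_to_yangian R.
(* [f \o g] and the identity agree on the entries of [mrea_M R]. *)
have gK : cancel g f.
  apply: (presented_lrmorphism_ext (f := f \o g) (g := idfun)) => -[i j].
  by have /matrixP/(_ i j) := f1; rewrite -gM !mxE.
split; last by exists g; split=> //; apply: can_inj gK.
by exists f; split=> // y; exists (g y).
Qed.
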